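(* With $A(n)$ and $A'(n)$ as defined in the context: (a) $$\sum_{n\ge1}A(n)q^n=2q(-q^2;q)_\infty^2(-q^2;q^2)_\infty^2-\frac{q}{(1+q)^2}=2q(-q^2;q)_\infty^2(-q^2;q^2)_\infty^2+\sum_{n\ge1}(-1)^n n q^n;$$ (b) $$\sum_{n\ge1}A'(n)q^n=\frac{q}{(1-q)^2}=\sum_{n\ge1}nq^n.$$
   Context: $(a;q)_\infty=\prod_{j\ge0}(1-aq^j)$, $|q|<1$. A two-color partition is a partition whose parts are each colored blue or green (the same integer may occur in both colors). For a positive integer $n$, $A(n)$ is the number of two-color partitions of $n$ in which: the smallest part $s$ is odd, occurs at least once in blue, and every blue even part is at least $s+3$; no even integer occurs more than once in the same color (odd parts of either color may repeat). $A_0(n)$ (resp. $A_1(n)$) is the number of partitions counted by $A(n)$ whose total number of even parts (both colors) is even (resp. odd), and $A'(n)=A_0(n)-A_1(n)$. Equivalently, $\sum_{n\ge1}A(n)q^n=\sum_{n\ge0}\frac{q^{2n+1}(-q^{2n+4};q^2)_\infty(-q^{2n+2};q^2)_\infty}{(q^{2n+1};q^2)_\infty^2}$ and $\sum_{n\ge1}A'(n)q^n=\sum_{n\ge0}\frac{q^{2n+1}(q^{2n+4};q^2)_\infty(q^{2n+2};q^2)_\infty}{(q^{2n+1};q^2)_\infty^2}$. *)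

(* Defs.v *)
From HB Require Import structures.
From mathcomp Require Import all_boot all_order all_algebra.
From mathcomp Require Import complex.
From mathcomp Require Import all_classical all_reals all_analysis.
Set Implicit Arguments.
Unset Strict Implicit.
Unset Printing Implicit Defensive.

Import Order.TTheory GRing.Theory Num.Theory.
Import numFieldNormedType.Exports.

Local Open Scope ring_scope.

(* A color is a boolean so as to inherit its finite type structure. *)
Definition color : finType := bool.
Definition blue : color := true.
Definition green : color := false.

(* [m (c, i)] is the number of occurrences of the part [i] in color [c].  In a
   partition of [n] every part and every multiplicity is at most [n], so that
   bounding both by [n] loses no two-color partition of [n]. *)
Definition multiplicities (n : nat) : finType :=
  {ffun color * 'I_n.+1 -> 'I_n.+1}.

Section TwoColorPartitions.
Local Open Scope nat_scope.

Definition two_color_partition n (m : multiplicities n) : bool :=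
  [forall c : color, m (c, ord0) == 0 :> nat] &&
  (\sum_(ci : color * 'I_n.+1) m ci * ci.2 == n).

Definition smallest_part n (m : multiplicities n) (s : 'I_n.+1) : bool :=
  [exists c : color, 0 < m (c, s)] &&
  [forall ci : color * 'I_n.+1, (0 < m ci) ==> (s <= ci.2)].

Definition admissible n (m : multiplicities n) : bool :=
  [exists s : 'I_n.+1,
     [&& smallest_part m s,
         odd s,
         0 < m (blue, s) &
         [forall i : 'I_n.+1,
            (0 < m (blue, i)) && ~~ odd i ==> (s + 3 <= i)]]] &&
  [forall ci : color * 'I_n.+1, ~~ odd ci.2 ==> (m ci <= 1)].

Definition number_of_even_parts n (m : multiplicities n) : nat :=
  \sum_(ci : color * 'I_n.+1 | ~~ odd ci.2) m ci.

Definition A (n : nat) : nat :=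
  #|[set m : multiplicities n | two_color_partition m && admissible m]|.

Definition A0 (n : nat) : nat :=
  #|[set m : multiplicities n | [&& two_color_partition m, admissible m
      & ~~ odd (number_of_even_parts m)]]|.

Definition A1 (n : nat) : nat :=
  #|[set m : multiplicities n | [&& two_color_partition m, admissible m
      & odd (number_of_even_parts m)]]|.

End TwoColorPartitions.

Definition A' (n : nat) : int := (A0 n)%:Z - (A1 n)%:Z.

(* The ascription to [numClosedFieldType] is what gives the complex numbers
   their norm topology. *)
Definition C (R : realType) : numClosedFieldType := R[i].

Definition qpoch_inf (R : realType) (a q : C R) : C R :=
  \big[*%R/1]_(0 <= j <oo) (1 - a * q ^+ j).

(* Main.v *)
(* Let s = 2t+1 be the least part and give every even part the weight w, with
   w = 1 for A and w = -1 for A'.  Grouping, for each j, the green part 2j, the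
   odd part 2j+1 and the blue part 2j+2 into level j, the partitions with least
   part s have generating function
     q^s / d_t * prod_(j > t) (u_j / d_j),
     u_j = (1 + w q^(2j)) (1 + w q^(2j+2)),   d_j = (1 - q^(2j+1))^2.
   Since d_t - u_t = - w q^(2t) (1 + w q)^2 when w^2 = 1, the sum over t
   telescopes to - w q (1 + w q)^(-2) (1 - prod_j (u_j / d_j)).  For w = -1 the
   factor u_0 vanishes.  For w = 1, Euler's identity
   prod_j (1 - q^(2j+1)) prod_i (1 + q^i) = 1 turns the product into the stated
   one.  All this takes place in integer polynomials modulo X^(n+1).

   The resulting coefficients A(n) - (-1)^n n are those of an increasing sequence
   of polynomials with nonnegative coefficients, whose values at |q| are bounded;
   this dominates the partial sums and yields the identity of functions. *)

Require Import Defs.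
From mathcomp Require Import all_boot all_order all_algebra.
From mathcomp Require Import complex.
From mathcomp Require Import all_classical all_reals all_analysis.
From mathcomp Require Import ring zify.
Import Order.TTheory GRing.Theory Num.Theory.
Import numFieldNormedType.Exports.
Local Open Scope classical_set_scope.
Local Open Scope ring_scope.

(** * Integer polynomials modulo powers of the variable *)

(* Congruence modulo 'X^n.+1. *)
Definition eqmodX (n : nat) (p q : {poly int}) := forall k, (k <= n)%N -> p`_k = q`_k.

Lemma eqmodX_refl n p : eqmodX n p p. Proof. by []. Qed.

Lemma eqmodX_sym n p q : eqmodX n p q -> eqmodX n q p.
Proof. by move=> h k kn; rewrite h. Qed.

Lemma eqmodX_trans n q p r : eqmodX n p q -> eqmodX n q r -> eqmodX n p r.
Proof. by move=> pq qr k kn; rewrite pq // qr. Qed.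

Lemma eqmodXD n p q p' q' : eqmodX n p q -> eqmodX n p' q' -> eqmodX n (p + p') (q + q').
Proof. by move=> h h' k kn; rewrite !coefD h // h'. Qed.

Lemma eqmodXB n p q p' q' : eqmodX n p q -> eqmodX n p' q' -> eqmodX n (p - p') (q - q').
Proof. by move=> h h' k kn; rewrite !coefB h // h'. Qed.

Lemma eqmodXM n p q p' q' : eqmodX n p q -> eqmodX n p' q' -> eqmodX n (p * p') (q * q').
Proof.
move=> h h' k kn; rewrite !coefM; apply: eq_bigr => i _.
by rewrite h ?h' // (leq_trans _ kn) ?leq_subr // -ltnS.
Qed.

Lemma eqmodXMl1 n p q r : eqmodX n p 1 -> eqmodX n q r -> eqmodX n (p * q) r.
Proof. by move=> h h'; rewrite -(mul1r r); exact: eqmodXM. Qed.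

Lemma eqmodXMr1 n p q r : eqmodX n q 1 -> eqmodX n p r -> eqmodX n (p * q) r.
Proof. by move=> h h'; rewrite -(mulr1 r); exact: eqmodXM. Qed.

Lemma eqmodX_sum n (I : Type) (r : seq I) (Q : pred I) (F G : I -> {poly int}) :
  (forall i, Q i -> eqmodX n (F i) (G i)) ->
  eqmodX n (\sum_(i <- r | Q i) F i) (\sum_(i <- r | Q i) G i).
Proof. by move=> h; elim/big_ind2: _ => // *; exact: eqmodXD. Qed.

Lemma eqmodX_prod n (I : Type) (r : seq I) (Q : pred I) (F G : I -> {poly int}) :
  (forall i, Q i -> eqmodX n (F i) (G i)) ->
  eqmodX n (\prod_(i <- r | Q i) F i) (\prod_(i <- r | Q i) G i).
Proof. by move=> h; elim/big_ind2: _ => // *; exact: eqmodXM. Qed.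

Lemma eqmodX_XnM n k p : (n < k)%N -> eqmodX n ('X^k * p) 0.
Proof. by move=> nk i ik; rewrite coefXnM coef0 (leq_ltn_trans ik nk). Qed.

Lemma eqmodX_Xn n k : (n < k)%N -> eqmodX n 'X^k 0.
Proof. by move=> nk; rewrite -['X^k]mulr1; exact: eqmodX_XnM. Qed.

Lemma eqmodX_prod_extend n m m' (F : nat -> {poly int}) :
  (m <= m')%N -> (forall i, (m <= i)%N -> eqmodX n (F i) 1) ->
  eqmodX n (\prod_(i < m) F i) (\prod_(i < m') F i).
Proof.
move=> mm' h; rewrite -!(big_mkord xpredT F) (big_cat_nat (n := m) (p := m')) //=.
apply: eqmodX_sym; apply: eqmodXMr1 => //.
rewrite big_nat; elim/big_ind: _ => // [p q|i /andP[mi _]]; first exact: eqmodXMl1.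
exact: h.
Qed.

(** A polynomial with constant term 1 is invertible as a power series. By strong induction on k, the
    coefficient of X^k in d (p - q) is that of p - q plus terms in lower coefficients of p - q,
    already zero. *)
Lemma eqmodX_mulI n (d p q : {poly int}) : d`_0 = 1 -> eqmodX n (d * p) (d * q) -> eqmodX n p q.
Proof.
move=> d0 h.
suff H k : (k <= n)%N -> (p - q)`_k = 0.
  by move=> k kn; apply/eqP; rewrite -subr_eq0 -coefB H.
elim/ltn_ind: k => k IH kn.
have := h k kn; move/eqP; rewrite -subr_eq0 -coefB -mulrBr coefM big_ord_recl.
rewrite /= d0 mul1r subn0 big1 ?addr0 => [/eqP //|i _].
by rewrite IH ?mulr0 // /bump /=; have := ltn_ord i; lia.
Qed.

Lemma prod_coef0 (I : Type) (r : seq I) (Q : pred I) (F : I -> {poly int}) :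
  (forall i, Q i -> (F i)`_0 = 1) -> (\prod_(i <- r | Q i) F i)`_0 = 1.
Proof.
move=> h; apply: (big_ind (fun p : {poly int} => p`_0 = 1)) => //.
  by rewrite coef1.
by move=> p q p0 q0; rewrite coef0M p0 q0 mulr1.
Qed.

Lemma big_ord_double (R : Type) (idx : R) (op : Monoid.law idx) M (h : nat -> R) :
  \big[op/idx]_(i < M.*2) h i = \big[op/idx]_(j < M) op (h j.*2) (h j.*2.+1).
Proof.
elim: M => [|M IH]; first by rewrite !big_ord0.
by rewrite doubleS !big_ord_recr /= IH -Monoid.mulmA.
Qed.

(** * The telescoping sum *)

(* Whether the part [i] may occur [k] times in the color [c] when the least part
   is [s]; [c] is true for blue. *)
Definition allowed (s : nat) (c : bool) (i k : nat) : bool :=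
  [&& (0 < k)%N ==> (s <= i)%N, ~~ odd i ==> (k <= 1)%N,
      [&& (0 < k)%N, c & ~~ odd i] ==> (s + 3 <= i)%N &
      c && (i == s) ==> (0 < k)%N].

(** One factor of the generating function. Multiplicities are cut off at [n] just as in
    [multiplicities n], so that the product over all colored parts expands into a sum over these. *)
Definition part_poly (w : int) (n s : nat) (c : bool) (i : nat) : {poly int} :=
  \sum_(k < n.+1 | allowed s c i k) (w ^+ (~~ odd i * k))%:P * 'X^(k * i).

Lemma part_poly_out w n s c i : i != s ->
  (forall k, (0 < k <= n)%N -> allowed s c i k -> (n < k * i)%N) ->
  eqmodX n (part_poly w n s c i) 1.
Proof.
move=> is_ h; rewrite /part_poly big_mkcond big_ord_recl /=.
have -> : allowed s c i 0 by rewrite /allowed (negPf is_) /= andbF implybT.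
rewrite muln0 mul0n !expr0 mulr1 -[X in eqmodX _ _ X]addr0.
apply: eqmodXD => //; apply: (@eqmodX_trans _ (\sum_(i < n) 0)); last by rewrite big1.
apply: eqmodX_sum => k _; case: ifP => // ak; rewrite mulrC; apply: eqmodX_XnM.
by apply: h ak; rewrite /= /bump /=; have := ltn_ord k; lia.
Qed.

Lemma part_poly_even w n s c i : (0 < n)%N -> ~~ odd i -> odd s ->
  (s < i)%N -> c ==> (s + 3 <= i)%N -> part_poly w n s c i = 1 + w%:P * 'X^i.
Proof.
case: n => // n _ ei os si ci; rewrite /part_poly big_mkcond 2!big_ord_recl big1 => [|k _].
  rewrite /= /bump /= /allowed ei (ltnW si) /= !implybT /=.
  rewrite (_ : i == s = false) ?andbF /=; last by lia.
  by rewrite !andbT ci !(addn0, muln0, mul0n, mul1n, expr0, expr1, mulr1, addr0).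
by rewrite /= /bump /= /allowed ei /= andbF.
Qed.

Lemma geom_truncated n i (x : {poly int}) :
  (1 - x ^+ i) * (\sum_(k < n) x ^+ (k * i)) = 1 - x ^+ (n * i).
Proof.
elim: n => [|n IH]; first by rewrite big_ord0 mulr0 mul0n subrr.
rewrite big_ord_recr /= mulrDr IH mulSn exprD; ring.
Qed.

(** Cutting the geometric series off leaves the error X^((n+1)i), of degree above [n] because [i],
    being odd, is positive. *)
Lemma part_poly_odd w n s c i : odd i -> (s <= i)%N -> ~~ (c && (i == s)) ->
  eqmodX n ((1 - 'X^i) * part_poly w n s c i) 1.
Proof.
move=> oi si ci; rewrite /part_poly.
rewrite (eq_bigl xpredT) => [|k]; last first.
  by rewrite /allowed oi si (negPf ci) !andbF !implybT.
rewrite (eq_bigr (fun k : 'I_n.+1 => 'X^(k * i))) => [|k _]; last by rewrite oi expr0 mul1r.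
rewrite geom_truncated -[X in eqmodX _ _ X]subr0; apply: eqmodXB => //.
by apply: eqmodX_Xn; case: i oi {si ci} => // i _; rewrite mulnS; lia.
Qed.

(** The least part must occur in blue, so the term k = 0 is missing and the geometric series starts
    at X^s. *)
Lemma part_poly_least w n s : odd s -> eqmodX n ((1 - 'X^s) * part_poly w n s true s) 'X^s.
Proof.
move=> os; rewrite /part_poly.
rewrite big_mkcond big_ord_recl /= /allowed leqnn eqxx os /= add0r.
rewrite (eq_bigr (fun k : 'I_n => 'X^s * 'X^(k * s))) => [|k _]; last first.
  by rewrite /bump /= expr0 mul1r add1n mulSn exprD.
rewrite -big_distrr mulrCA /= geom_truncated mulrBr mulr1 -[X in eqmodX _ _ X]subr0.
apply: eqmodXB => //; rewrite -exprD; apply: eqmodX_Xn.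
by case: s os => // s _; rewrite mulnS; lia.
Qed.

(** [odd_level] is d_j and [even_level] is u_j. Multiplying by d_j instead of dividing keeps
    everything polynomial. *)
Definition odd_level (j : nat) : {poly int} := (1 - 'X^(j.*2.+1)) ^+ 2.
Definition even_level (w : int) (j : nat) : {poly int} :=
  (1 + w%:P * 'X^(j.*2)) * (1 + w%:P * 'X^(j.*2.+2)).

Lemma part_poly_lt w n s c i : (i < s)%N -> eqmodX n (part_poly w n s c i) 1.
Proof.
move=> si; apply: part_poly_out => [|k /andP[k0 _]]; first by rewrite neq_ltn si.
by rewrite /allowed k0 leqNgt si.
Qed.

(** Multiplying by d_j cancels the odd geometric series. Below level t nothing may occur, so d_j
    survives. At level t the green part 2t is too small and the blue part 2t+2 = s+1 is excluded by
    the bound s+3, which leaves X^s. Above level t both even parts are free, the blue one since 2j+2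
    >= s+3. *)
Lemma level_part_poly w n t j : (0 < n)%N ->
  eqmodX n (odd_level j * (part_poly w n t.*2.+1 true j.*2.+1 * part_poly w n t.*2.+1 false j.*2 *
        (part_poly w n t.*2.+1 true j.*2.+2 * part_poly w n t.*2.+1 false j.*2.+1)))
   (if (j < t)%N then odd_level j else if j == t then 'X^(t.*2.+1) else even_level w j).
Proof.
move=> n0.
have regroup (a b c e g : {poly int}) : a ^+ 2 * (b * c * (e * g)) = (a * b) * (a * g) * (c * e).
  by ring.
case: ltngtP => jt.
- by apply: eqmodXMr1 => //; apply: eqmodXMr1; apply: eqmodXMr1; apply: part_poly_lt; lia.
- rewrite /odd_level regroup.
  apply: eqmodXMl1; last by rewrite !part_poly_even //; lia.
  by apply: eqmodXMl1; apply: part_poly_odd; lia.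
- rewrite /odd_level jt regroup.
  apply: eqmodXMr1.
    apply: eqmodXMl1; first by apply: part_poly_lt; lia.
    apply: part_poly_out => [|k]; first by lia.
    by rewrite /allowed; lia.
  by apply: eqmodXMr1; [apply: part_poly_odd|apply: part_poly_least]; lia.
Qed.

(* Level [j] consists of the green part 2j, the blue and green parts 2j+1 and the
   blue part 2j+2: this shift of the blue parts makes the telescoping exact. *)
Definition level_prod w n s M : {poly int} :=
  \prod_(i < M.*2) (part_poly w n s true i.+1 * part_poly w n s false i).

Lemma level_prodE w n t M : (0 < n)%N -> (t < M)%N ->
  eqmodX n ((\prod_(j < M) odd_level j) * level_prod w n t.*2.+1 M)
   ('X^(t.*2.+1) * ((\prod_(j < t) odd_level j) * \prod_(t.+1 <= j < M) even_level w j)).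
Proof.
move=> n0 tM; rewrite /level_prod.
rewrite (big_ord_double _ _ _ _
  (fun i => part_poly w n t.*2.+1 true i.+1 * part_poly w n t.*2.+1 false i)).
rewrite -big_split /=.
apply: eqmodX_trans; first by apply: eqmodX_prod => j _; exact: level_part_poly.
rewrite -(big_mkord xpredT (fun j =>
  if (j < t)%N then odd_level j else if j == t then 'X^(t.*2.+1) else even_level w j)).
rewrite (big_cat_nat (n := t)) ?(ltnW tM) //= (big_ltn tM) ltnn eqxx.
rewrite mulrCA; apply: eqmodXM => //; apply: eqmodXM.
  by rewrite big_mkord; apply: eqmodX_prod => j _; rewrite ltn_ord.
rewrite !big_seq; apply: eqmodX_prod => j; rewrite mem_index_iota => /andP[tj _].
by rewrite ltnNge (ltnW tj) /= gtn_eqF.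
Qed.

(** The two products differ only by the blue part 0, which lies below [s], and by parts above [n];
    all of these contribute 1. *)
Lemma prod_part_poly w n s M : odd s -> (s <= n)%N -> (n < M.*2)%N ->
  eqmodX n (\prod_(ci : bool * 'I_n.+1) part_poly w n s ci.1 ci.2) (level_prod w n s M).
Proof.
move=> os sn nM.
have big c i : (n < i)%N -> eqmodX n (part_poly w n s c i) 1.
  move=> ni; apply: part_poly_out; first by lia.
  by move=> k /andP[k0 _] _; rewrite (leq_trans ni) // leq_pmull.
have ext c m : (n < m)%N ->
    eqmodX n (\prod_(i < n.+1) part_poly w n s c i) (\prod_(i < m) part_poly w n s c i).
  by move=> nm; apply: (eqmodX_prod_extend _ _ _ (part_poly w n s c)) => // i; exact: big.
rewrite -(pair_bigA _ (fun c (i : 'I_n.+1) => part_poly w n s c i)) /= big_bool /=.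
rewrite /level_prod big_split /=; apply: eqmodXM; last exact: ext.
apply: eqmodX_trans; first by apply: (ext _ M.*2.+1); lia.
rewrite big_ord_recl /= -[X in eqmodX _ _ X]mul1r; apply: eqmodXM => //.
by apply: part_poly_lt; lia.
Qed.

(** Induction on [M]: with D and U the two products, D d - U u = (D - U) u + D (d - u). The factor u
    multiplies all earlier summands, and X D (d - u) is the new one. *)
Lemma telescope_level_prod w M : w ^+ 2 = 1 ->
  - w%:P * (1 + w%:P * 'X) ^+ 2 *
  (\sum_(t < M) 'X^(t.*2.+1) * ((\prod_(j < t) odd_level j) * \prod_(t.+1 <= j < M) even_level w j)) =
  'X * ((\prod_(j < M) odd_level j) - \prod_(j < M) even_level w j).
Proof.
move=> w2; have w2P : w%:P ^+ 2 = 1 :> {poly int} by rewrite -rmorphXn /= w2.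
have dE j : odd_level j - even_level w j = - w%:P * 'X^(j.*2) * (1 + w%:P * 'X) ^+ 2.
  have gen (W x y : {poly int}) : W ^+ 2 = 1 -> (1 - x * y) ^+ 2 -
      (1 + W * y) * (1 + W * (x * (x * y))) = - W * y * (1 + W * x) ^+ 2.
    by move=> W2; ring: W2.
  by rewrite -gen // -!exprS.
elim: M => [|M IH]; first by rewrite !big_ord0 mulr0 subrr mulr0.
rewrite !big_ord_recr /= big_geq // mulr1.
rewrite (eq_bigr (fun t : 'I_M => ('X^(t.*2.+1) *
  ((\prod_(j < t) odd_level j) * \prod_(t.+1 <= j < M) even_level w j)) *
  even_level w M)); last first.
  by move=> t _; rewrite big_nat_recr //= !mulrA.
rewrite -big_distrl /= mulrDr mulrA IH.
have -> : odd_level M = even_level w M + - w%:P * 'X^(M.*2) * (1 + w%:P * 'X) ^+ 2.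
  by rewrite -dE addrC subrK.
rewrite (exprS 'X M.*2); ring.
Qed.

Definition gen_poly w n : {poly int} :=
  \sum_(s < n.+1 | odd s) \prod_(ci : bool * 'I_n.+1) part_poly w n s ci.1 ci.2.

Lemma gen_poly_telescope w n M : w ^+ 2 = 1 -> (0 < n)%N -> (n < M.*2)%N ->
  eqmodX n (- w%:P * (1 + w%:P * 'X) ^+ 2 * ((\prod_(j < M) odd_level j) * gen_poly w n))
    ('X * ((\prod_(j < M) odd_level j) - \prod_(j < M) even_level w j)).
Proof.
move=> w2 n0 nM; rewrite -telescope_level_prod //; apply: eqmodXM => //.
pose F s := 'X^s * ((\prod_(j < s./2) odd_level j) * \prod_(s./2.+1 <= j < M) even_level w j).
have sumF : \sum_(s < M.*2 | odd s) F s =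
    \sum_(t < M) 'X^(t.*2.+1) * ((\prod_(j < t) odd_level j) * \prod_(t.+1 <= j < M) even_level w j).
  rewrite big_mkcond (big_ord_double _ _ _ _ (fun s => if odd s then F s else 0)).
  by apply: eq_bigr => t _; rewrite /= odd_double /= add0r /F /= uphalf_double.
rewrite -sumF /gen_poly big_distrr /=.
apply: (@eqmodX_trans _ (\sum_(s < n.+1 | odd s) F s)).
  apply: eqmodX_sum => s os; apply: eqmodX_trans.
    apply: eqmodXM; first exact: eqmodX_refl.
    by apply: (prod_part_poly w n s M os _ nM); rewrite -ltnS.
  rewrite /F; have {1 2}-> : s = s./2.*2.+1 :> nat by have := odd_double_half s; rewrite os; lia.
  by apply: level_prodE => //; have := ltn_ord s; lia.
(* The least parts from n+1 up to 2M-1 contribute multiples of X^s, zero modulo X^(n+1). *)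
rewrite -!(big_mkord odd) /= [X in eqmodX _ _ X](big_cat_nat (n := n.+1)) //=.
rewrite -[X in eqmodX _ X]addr0; apply: eqmodXD => //; apply: eqmodX_sym.
rewrite big_seq_cond; apply: (@eqmodX_trans _ (\sum_(i <- index_iota n.+1 M.*2 |
  (i \in index_iota n.+1 M.*2) && odd i) 0)); last by rewrite big1.
by apply: eqmodX_sum => j; rewrite mem_index_iota => /andP[/andP[nj _] _]; exact: eqmodX_XnM.
Qed.

(** * Coefficients of the generating polynomials *)

Lemma eqmodX_1DXn n k (c : {poly int}) : (n < k)%N -> eqmodX n (1 + c * 'X^k) 1.
Proof.
by move=> nk; rewrite mulrC -[X in eqmodX _ _ X]addr0; apply: eqmodXD => //; exact: eqmodX_XnM.
Qed.

(** Finite form of sum k y^k = y / (1 - y)^2, used for polynomials as well as for real and complex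
    numbers. *)
Lemma sum_arith_geom (R : comNzRingType) (y : R) N :
  (1 - y) ^+ 2 * (\sum_(k < N.+1) k%:R * y ^+ k) =
  y - N.+1%:R * y ^+ N.+1 + N%:R * y ^+ N.+2.
Proof.
elim: N => [|N IH]; first by rewrite big_ord_recr big_ord0 /=; ring.
rewrite big_ord_recr /= mulrDr IH -(natr1 N.+1) -(natr1 N) !exprS; ring.
Qed.

(** After multiplication by the even factors 1 - X^(2j+2), j < M, the left side becomes the product
    of (1 + X^k)(1 - X^k) = 1 - X^(2k) over 1 <= k <= 2M, whose first M factors are the ones
    multiplied in. *)
Lemma euler_truncated M :
  (\prod_(i < M.*2) (1 + 'X^(i.+1))) * (\prod_(j < M) (1 - 'X^(j.*2.+1))) =
  \prod_(M <= i < M.*2) (1 - 'X^(i.+1.*2)) :> {poly int}.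
Proof.
have nz k : 1 - 'X^(k.+1) != 0 :> {poly int}.
  apply/eqP => /(congr1 (fun p : {poly int} => p`_0)).
  by rewrite coefB coef1 coefXn coef0.
apply: (mulIf (x := \prod_(j < M) (1 - 'X^(j.*2.+2)))).
  by apply/prodf_neq0 => i _; exact: nz.
rewrite -mulrA -big_split /=.
rewrite -(big_ord_double _ _ _ _ (fun i => 1 - 'X^(i.+1))) -big_split /=.
rewrite (eq_bigr (fun i : 'I_M.*2 => 1 - 'X^(i.+1.*2))) => [|i _]; last first.
  by rewrite -(addnn i.+1) exprD; ring.
rewrite -(big_mkord xpredT (fun i => 1 - 'X^(i.+1.*2))) (big_cat_nat (n := M)) //=; last by lia.
by rewrite big_mkord mulrC.
Qed.

Lemma eqmodX_euler n M : (n < M.*2)%N ->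
  eqmodX n ((\prod_(i < M.*2) (1 + 'X^(i.+1))) ^+ 2 * \prod_(j < M) odd_level j) 1.
Proof.
move=> nM; rewrite /odd_level prodrXl -exprMn euler_truncated expr2.
suff h : eqmodX n (\prod_(M <= i < M.*2) (1 - 'X^(i.+1.*2))) 1 by exact: eqmodXMl1.
rewrite big_nat; elim/big_ind: _ => // [p q|i /andP[mi _]]; first exact: eqmodXMl1.
by rewrite -[_^+_]mul1r -mulNr; apply: eqmodX_1DXn; lia.
Qed.

(** Truncation of 2q (-q^2;q)^2 (-q^2;q^2)^2 after [K] factors in each infinite product. *)
Definition main_poly K : {poly int} :=
  2 * 'X * (\prod_(i < K) (1 + 'X^(i.+2))) ^+ 2 * (\prod_(i < K) (1 + 'X^(i.+1.*2))) ^+ 2.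

Lemma main_poly_stable n K K' : (n <= K)%N -> (K <= K')%N -> eqmodX n (main_poly K) (main_poly K').
Proof.
move=> nK KK'.
have odds : eqmodX n (\prod_(i < K) (1 + 'X^(i.+2))) (\prod_(i < K') (1 + 'X^(i.+2))).
  apply: (eqmodX_prod_extend _ _ _ (fun i => 1 + 'X^(i.+2))) => // i Ki.
  by rewrite -['X^_]mul1r; apply: eqmodX_1DXn; lia.
have evens : eqmodX n (\prod_(i < K) (1 + 'X^(i.+1.*2))) (\prod_(i < K') (1 + 'X^(i.+1.*2))).
  apply: (eqmodX_prod_extend _ _ _ (fun i => 1 + 'X^(i.+1.*2))) => // i Ki.
  by rewrite -['X^_]mul1r; apply: eqmodX_1DXn; lia.
by rewrite /main_poly !expr2; apply: eqmodXM; apply: eqmodXM => //; apply: eqmodXM.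
Qed.

(** At w = 1 the factor 1 + X^0 supplies the 2, and the two halves of the u_j become two copies of
    the product of 1 + X^(2i+2). The factor (1 + X)^2 appears because [main_poly] starts its other
    product at X^2. *)
Lemma prod_even_level1 n M : (n < M.*2)%N ->
  eqmodX n ('X * (\prod_(j < M) even_level 1 j) * (\prod_(i < M.*2) (1 + 'X^(i.+1))) ^+ 2)
        ((1 + 'X) ^+ 2 * main_poly n).
Proof.
case: M => // M nM.
have -> : \prod_(j < M.+1) even_level 1 j =
   (2 * \prod_(i < M) (1 + 'X^(i.+1.*2))) * \prod_(i < M.+1) (1 + 'X^(i.+1.*2)).
  rewrite /even_level big_split /= big_ord_recl /= !mul1r expr0; congr (_ * _ * _);
    apply: eq_bigr => i _;
    by rewrite mul1r.
have -> : \prod_(i < M.+1.*2) (1 + 'X^(i.+1)) =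
    (1 + 'X) * \prod_(i < M.*2.+1) (1 + 'X^(i.+2)) :> {poly int}.
  by rewrite doubleS big_ord_recl.
have -> : forall a b c : {poly int}, 'X * (2 * a * b) * ((1 + 'X) * c) ^+ 2 =
    (1 + 'X) ^+ 2 * (2 * 'X * (c * c) * (a * b)) by move=> *; ring.
rewrite /main_poly !expr2.
(* Either of [n] and [M] may be the larger, so truncations are compared through a longer one, of
   length [n + M.+1]. *)
have extend k : (n <= k.*2.+1)%N -> (k <= n + M.+1)%N ->
    eqmodX n (\prod_(i < k) (1 + 'X^(i.+1.*2))) (\prod_(i < n + M.+1) (1 + 'X^(i.+1.*2))).
  move=> nk kL; apply: (eqmodX_prod_extend _ _ _ (fun i => 1 + 'X^(i.+1.*2))) => // i Ki.
  by rewrite -['X^_]mul1r; apply: eqmodX_1DXn; lia.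
have even k : (n <= k.*2.+1)%N -> (k <= M.+1)%N ->
    eqmodX n (\prod_(i < k) (1 + 'X^(i.+1.*2))) (\prod_(i < n) (1 + 'X^(i.+1.*2))).
  move=> nk kM; apply: eqmodX_trans; first by apply: extend => //; lia.
  by apply: eqmodX_sym; apply: extend; lia.
have all : eqmodX n (\prod_(i < M.*2.+1) (1 + 'X^(i.+2))) (\prod_(i < n) (1 + 'X^(i.+2))).
  apply: eqmodX_sym;
    apply: (eqmodX_prod_extend _ _ _ (fun i => 1 + 'X^(i.+2))) => [|i Ki]; first by lia.
  by rewrite -['X^_]mul1r; apply: eqmodX_1DXn; lia.
apply: eqmodXM => //; apply: eqmodXM; first by apply: eqmodXM => //; apply: eqmodXM.
by apply: eqmodXM; apply: even; lia.
Qed.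

Lemma coef_arith (c : int) n m : (n <= m)%N ->
  (\sum_(k < m.+1) k%:R * (c%:P * 'X) ^+ k : {poly int})`_n = n%:R * c ^+ n.
Proof.
move=> nm.
rewrite (_ : \sum_(k < m.+1) _ = \poly_(k < m.+1) (k%:R * c ^+ k)) ?coef_poly ?ltnS ?nm //.
rewrite poly_def; apply: eq_bigr => k _.
by rewrite exprMn -rmorphXn /= mulrA -mul_polyC rmorphM /= rmorph_nat.
Qed.

Lemma eqmodX_arith (c : {poly int}) n :
  eqmodX n ((1 - c * 'X) ^+ 2 * (\sum_(k < n.+1) k%:R * (c * 'X) ^+ k)) (c * 'X).
Proof.
rewrite sum_arith_geom !exprMn -addrA -[X in eqmodX _ _ X]addr0; apply: eqmodXD => //.
rewrite -(addr0 0); apply: eqmodXD.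
  by rewrite -mulNr mulrA mulrC; apply: eqmodX_XnM.
by rewrite mulrA mulrC; apply: eqmodX_XnM.
Qed.

Lemma coef_gen_polyN1 n : (0 < n)%N -> (gen_poly (-1) n)`_n = n%:R.
Proof.
move=> n0; have nM : (n < n.+1.*2)%N by lia.
have := gen_poly_telescope (-1) n n.+1 (sqrr_sign _ 1) n0 nM.
(* The first half of u_0 is 1 + w = 0, so the subtracted product vanishes. *)
rewrite [\prod_(j < n.+1) even_level _ j]big_ord_recl /even_level /=.
rewrite expr0 mulr1 rmorphN rmorph1 /= !mulN1r opprK subrr !mul0r subr0 mul1r => h.
have {}h : eqmodX n ((1 - 'X) ^+ 2 * gen_poly (-1) n) 'X.
  apply: (eqmodX_mulI n (\prod_(j < n.+1) odd_level j)).
    apply: prod_coef0 => j _.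
    by rewrite /odd_level expr2 coef0M coefB coef1 coefXn subr0 mulr1.
  by rewrite mulrCA [X in eqmodX _ _ X]mulrC.
have := eqmodX_arith 1 n; rewrite !mul1r => h'.
have := eqmodX_mulI n ((1 - 'X) ^+ 2) _ _ _ (eqmodX_trans _ _ _ _ h (eqmodX_sym _ _ _ h')).
rewrite expr2 coef0M coefB coef1 coefX subr0 mulr1 => /(_ erefl n (leqnn n)) ->.
by have := coef_arith 1 n n (leqnn n); rewrite rmorph1 !mul1r expr1n mulr1.
Qed.

(** Multiplying the telescoped identity by [E], the inverse of [D] by Euler's identity, isolates (1
    + X)^2 times [gen_poly 1 n]; then (1 + X)^2 is cancelled. *)
Lemma coef_gen_poly1 n : (0 < n)%N -> (gen_poly 1 n)`_n = (main_poly n)`_n + n%:R * (-1) ^+ n.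
Proof.
move=> n0; have nM : (n < n.+1.*2)%N by lia.
have := gen_poly_telescope 1 n n.+1 (expr1n _ _) n0 nM.
rewrite rmorph1 mul1r mulN1r.
set D := \prod_(j < _) odd_level _; set U := \prod_(j < _) _ => h.
have := eqmodX_euler n n.+1 nM; rewrite -/D => hE.
have := prod_even_level1 n n.+1 nM; rewrite -/U.
move: hE; set E := (\prod_(i < _) _) ^+ 2 => hE hU.
have := eqmodX_arith (-1) n; rewrite mulN1r opprK; set S := \sum_(k < _) _ => hS.
have : eqmodX n ((1 + 'X) ^+ 2 * gen_poly 1 n) ((1 + 'X) ^+ 2 * (main_poly n + S)).
  rewrite mulrDr; apply: (@eqmodX_trans _ ('X * U * E - 'X)); last first.
    by apply: eqmodX_sym; apply: eqmodXD => //; exact: eqmodX_sym.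
  apply: (@eqmodX_trans _ ((E * D) * ((1 + 'X) ^+ 2 * gen_poly 1 n))).
    by apply: eqmodX_sym; apply: eqmodXMl1.
  have -> : E * D * ((1 + 'X) ^+ 2 * gen_poly 1 n) =
    0 - E * (- (1 + 'X) ^+ 2 * (D * gen_poly 1 n)) by ring.
  have -> : 'X * U * E - 'X = 0 - ('X - 'X * U * E) by ring.
  apply: eqmodXB => //; apply: eqmodX_trans; first by apply: eqmodXM h; exact: eqmodX_refl.
  have -> : E * ('X * (D - U)) = (E * D) * 'X - 'X * U * E by ring.
  by apply: eqmodXB => //; exact: eqmodXMl1.
move/eqmodX_mulI; rewrite expr2 coef0M coefD coef1 coefX addr0 mulr1 => /(_ erefl n (leqnn n)) ->.
rewrite coefD; congr (_ + _).
by have := coef_arith (-1) n n (leqnn n); rewrite rmorphN rmorph1 mulN1r.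
Qed.

Lemma main_poly_nneg K : main_poly K \is a polyOver (@Num.Def.nneg_num_pred int).
Proof.
rewrite /main_poly; apply: rpredM; last first.
  by apply: rpredX; apply: rpred_prod => i _; rewrite rpredD ?rpred1 ?rpredX ?polyOverX.
apply: rpredM; last first.
  by apply: rpredX; apply: rpred_prod => i _; rewrite rpredD ?rpred1 ?rpredX ?polyOverX.
by rewrite rpredM ?polyOverX ?rpred_nat.
Qed.

Lemma main_poly_coef_ge0 K n : 0 <= (main_poly K)`_n.
Proof. by have /polyOverP/(_ n) := main_poly_nneg K. Qed.

(** The coefficients grow with [K] and are constant from K = n on. *)
Lemma main_poly_coef_le K n : (main_poly K)`_n <= (main_poly n)`_n.
Proof.
have step m : (main_poly m)`_n <= (main_poly m.+1)`_n.
  rewrite -subr_ge0 -coefB.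
  suff : main_poly m.+1 - main_poly m \is a polyOver (@Num.Def.nneg_num_pred int) by move/polyOverP/(_ n).
  (* With x = X^(m+2) and y = X^(2m+2), this is (1 + x)^2 (1 + y)^2 - 1 = x (2 + x) (1 + y)^2 + y (2
     + y). *)
  have -> : main_poly m.+1 - main_poly m = main_poly m *
     ('X^(m.+2) * (2 + 'X^(m.+2)) * (1 + 'X^(m.+1.*2)) ^+ 2 + 'X^(m.+1.*2) * (2 + 'X^(m.+1.*2))).
    rewrite /main_poly !big_ord_recr /=; ring.
  have nnX k : 'X^k \is a polyOver (@Num.Def.nneg_num_pred int) by rewrite rpredX ?polyOverX.
  have nnD c k : c%:R + 'X^k \is a polyOver (@Num.Def.nneg_num_pred int) by rewrite rpredD ?rpred_nat.
  apply: rpredM; first exact: main_poly_nneg.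
  apply: rpredD; last by apply: rpredM; [exact: nnX|exact: (nnD 2)].
  apply: rpredM; last by apply: rpredX; exact: (nnD 1).
  by apply: rpredM; [exact: nnX|exact: (nnD 2)].
case: (leqP n K) => nK; first by rewrite (main_poly_stable n n K).
have mono d : (main_poly K)`_n <= (main_poly (K + d))`_n.
  by elim: d => [|d IH]; [rewrite addn0 | rewrite addnS (le_trans IH)].
by have := mono (n - K)%N; rewrite subnKC // ltnW.
Qed.

(** * Counting two-color partitions *)

(** Admissibility with least part [s], apart from the parity of [s], as a separate condition on each
    colored part: the form in which a sum over multiplicities factors. *)
Definition least_part n (m : multiplicities n) (s : nat) : bool :=
  [forall ci : color * 'I_n.+1, allowed s ci.1 ci.2 (m ci)].

(** Each candidate occurs as a blue part and is therefore bounded below by the other. *)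
Lemma least_part_uniq n (m : multiplicities n) (s s' : 'I_n.+1) :
  least_part n m s -> least_part n m s' -> s = s'.
Proof.
have half (t t' : 'I_n.+1) : least_part n m t -> least_part n m t' -> (t <= t')%N.
  move=> /forallP/(_ (blue, t'))/= + /forallP/(_ (blue, t'))/=.
  by rewrite /allowed /= eqxx => /and4P[h _ _ _] /and4P[_ _ _ h']; exact: (implyP h h').
by move=> h h'; apply/val_inj/anti_leq; rewrite !half.
Qed.

Lemma two_color_admissibleE n (m : multiplicities n) :
  two_color_partition m && admissible m =
  (\sum_(ci : color * 'I_n.+1) m ci * ci.2 == n)%N &&
  [exists s : 'I_n.+1, odd s && least_part n m s].
Proof.
apply/andP/andP.
  move=> [/andP[/forallP m0 ->]
    /andP[/existsP[s /and4P[/andP[_ /forallP sm] os bs /forallP bl]] /forallP ev]].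
  split=> //; apply/existsP; exists s; rewrite os; apply/forallP => -[c i] /=.
  rewrite /allowed (sm (c, i)) (ev (c, i)) /=; apply/andP; split.
    apply/implyP => /and3P[mi cb ei].
    by case: c cb mi => // _ mi; apply: (implyP (bl i)); rewrite mi.
  by apply/implyP => /andP[cb /eqP/val_inj ->]; case: c cb.
move=> [sum_m /existsP[s /andP[os /forallP h]]]; split.
  apply/andP; split => //; apply/forallP => c.
  (* A part 0 would force s = 0, which is even. *)
  have /and4P[/implyP /= s0 _ _ _] := h (c, ord0).
  by case: posnP => // /s0; rewrite leqn0 => /eqP s_eq; rewrite s_eq in os.
apply/andP; split; last by apply/forallP => ci; have /and4P[] := h ci.
have bs : (0 < m (blue, s))%N.
  by have /and4P[_ _ _] := h (blue, s); rewrite /= eqxx.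
apply/existsP; exists s; rewrite os bs /=; apply/andP; split.
  apply/andP; split; first by apply/existsP; exists blue.
  by apply/forallP => ci; have /and4P[] := h ci.
apply/forallP => i; have /and4P[_ _ + _] := h (blue, i).
by [].
Qed.

(** Distributing the product of sums over the choices of multiplicities turns coefficient [n] into a
    sum over [multiplicities n]. After the sums are exchanged, uniqueness of the least part makes
    each partition count once. *)
Lemma weighted_count (w : int) n :
  \sum_(m : multiplicities n | two_color_partition m && admissible m)
     w ^+ number_of_even_parts m = (gen_poly w n)`_n.
Proof.
have coefE (s : 'I_n.+1) : (\prod_(ci : bool * 'I_n.+1) part_poly w n s ci.1 ci.2)`_n =
    \sum_(m : multiplicities n | least_part n m s)
      (if (\sum_(ci : color * 'I_n.+1) m ci * ci.2 == n)%N then w ^+ number_of_even_parts m else 0).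
  rewrite /part_poly (bigA_distr_big_dep (fun (ci : bool * 'I_n.+1) (k : 'I_n.+1) => allowed s ci.1 ci.2 k)
     (fun ci (k : 'I_n.+1) => (w ^+ (~~ odd ci.2 * k))%:P * 'X^(k * ci.2))) /=.
  rewrite coef_sum; apply: eq_big => [m|m _].
    by apply/familyP/forallP.
  rewrite big_split /= -rmorph_prod /= -!expr_sum coefCM coefXn eq_sym.
  case: ifP => _; last by rewrite mulr0.
  rewrite mulr1 /number_of_even_parts [in RHS]big_mkcond /=; congr (_ ^+ _); apply: eq_bigr => ci _.
  by case: (odd _); rewrite ?mul0n ?mul1n.
rewrite /gen_poly coef_sum (eq_bigr _ (fun s _ => coefE s)).
rewrite (exchange_big_dep xpredT) //= big_mkcond; apply: eq_bigr => m _.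
rewrite two_color_admissibleE; case: eqP => /= _; last by rewrite big1.
case: existsP => [[s /andP[os ms]]|none]; last first.
  by rewrite big_pred0 // => s; apply/negP => hs; apply: none; exists s.
by rewrite (big_pred1 s) // => t; apply/andP/eqP => [[_ mt]|-> //]; exact: least_part_uniq mt ms.
Qed.

Lemma A_gen_poly n : (A n)%:Z = (gen_poly 1 n)`_n.
Proof.
rewrite -weighted_count /A cardsE -sum1_card -natz natr_sum.
by apply: eq_bigr => m _; rewrite expr1n.
Qed.

Lemma A'_gen_poly n : A' n = (gen_poly (-1) n)`_n.
Proof.
rewrite -weighted_count /A' /A0 /A1 !cardsE -!sum1_card -!natz !natr_sum -sumrN.
rewrite [RHS](bigID (fun m => ~~ odd (number_of_even_parts m))) /=.
congr (_ + _); apply: eq_big => m.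
- by rewrite -topredE /= (andbA (two_color_partition m) (admissible m)).
- by rewrite -topredE /= -signr_odd => /and3P[_ _ /negPf ->].
- by rewrite -topredE /= (andbA (two_color_partition m) (admissible m)) negbK.
- by rewrite -topredE /= -signr_odd => /and3P[_ _ ->].
Qed.

(** * Series and products of complex numbers *)

Lemma norm_complexE (R : realType) (z : C R) : `|z| = (Normc.normc z)%:C%C.
Proof. by []. Qed.

Lemma cvg_complex (R : realType) (u : nat -> C R) (a b : R) :
  (fun n => complex.Re (u n)) @ \oo --> a -> (fun n => complex.Im (u n)) @ \oo --> b ->
  u @ \oo --> ((a +i* b)%C : C R).
Proof.
move=> ua ub; apply/cvgrPdist_lt => -[e e'].
(* The tolerance is a complex number; being positive, it is real. *)
rewrite ltcE /= => /andP[/eqP -> e0].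
have e2 : 0 < e / 2 by rewrite divr_gt0.
move/cvgrPdist_lt : ua => /(_ _ e2) ua; move/cvgrPdist_lt : ub => /(_ _ e2) ub.
near=> n; have ha : `|a - complex.Re (u n)| < e / 2 by near: n.
have hb : `|b - complex.Im (u n)| < e / 2 by near: n.
have -> : ((a +i* b)%C : C R) - u n = (a - complex.Re (u n))%:C%C + ((0 +i* (b - complex.Im (u n)))%C : C R).
  by case: (u n) => x y /=; apply/eqP; rewrite eq_complex /= addr0 add0r !eqxx.
apply: (le_lt_trans (ler_normD _ _)).
rewrite !norm_complexE /= expr0n /= addr0 add0r !sqrtr_sqr -rmorphD /= ltcR.
by rewrite (splitr e) ltrD.
Unshelve. all: by end_near. Qed.

Lemma le_norm_Re (R : realType) (z : C R) : `|complex.Re z| <= Normc.normc z.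
Proof. by rewrite -lecR; exact: normc_ge_Re. Qed.

Lemma le_norm_Im (R : realType) (z : C R) : `|complex.Im z| <= Normc.normc z.
Proof.
by case: z => x y /=; rewrite -(sqrtr_sqr y) ler_wsqrtr // lerDr sqr_ge0.
Qed.

(** Absolute convergence of the real and imaginary parts separately, both dominated by the
    modulus. *)
Lemma cvg_series_bounded (R : realType) (u : nat -> C R) (M : R) :
  (forall N, \sum_(0 <= n < N) Normc.normc (u n) <= M) -> cvgn (series u).
Proof.
move=> uM.
have key (f : nat -> R) : (forall n, `|f n| <= Normc.normc (u n)) -> cvgn (series f).
  move=> fu; apply: normed_cvg; apply: nondecreasing_is_cvgn.
    by apply/nondecreasing_seqP => n; rewrite /normed_series_of seriesSr lerDl normr_ge0.
  exists M => _ [N _ <-] /=; apply: le_trans (uM N); exact: ler_sum.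
have re := key (fun n => complex.Re (u n)) (fun n => le_norm_Re R (u n)).
have im := key (fun n => complex.Im (u n)) (fun n => le_norm_Im R (u n)).
apply/cvg_ex; eexists; apply: cvg_complex.
  rewrite (_ : (fun n => _) = series (fun n => complex.Re (u n))); first exact: re.
  by apply/funext => N; rewrite /series /= raddf_sum.
rewrite (_ : (fun n => _) = series (fun n => complex.Im (u n))); first exact: im.
by apply/funext => N; rewrite /series /= raddf_sum.
Qed.

Lemma cvg0_complex (R : realType) (v : nat -> C R) (e : nat -> R) :
  (forall n, Normc.normc (v n) <= e n) -> e @ \oo --> (0 : R) -> v @ \oo --> (0 : C R).
Proof.
move=> ve e0; apply: (cvg_complex R v 0 0); apply/norm_cvg0P;
  apply: (squeeze_cvgr _ (cvg_cst 0) e0); apply: nearW => n;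
  by rewrite normr_ge0 (le_trans _ (ve n)) ?le_norm_Re ?le_norm_Im.
Qed.

Lemma normcX (R : realType) (z : C R) n : Normc.normc (z ^+ n) = Normc.normc z ^+ n.
Proof. by elim: n => [|n IH]; rewrite ?expr0 ?Normc.normc1 // !exprS Normc.normcM IH. Qed.

Lemma normc_ge0 (R : realType) (z : C R) : 0 <= Normc.normc z.
Proof. exact: le_trans (normr_ge0 _) (le_norm_Re R z). Qed.

Lemma le_normc_sum (R : realType) (I : Type) (r : seq I) (P : pred I) (F : I -> C R) :
  Normc.normc (\sum_(i <- r | P i) F i) <= \sum_(i <- r | P i) Normc.normc (F i).
Proof.
rewrite -lecR -norm_complexE raddf_sum; exact: ler_norm_sum.
Qed.

Lemma normc_nat (R : realType) n : Normc.normc (n%:R : C R) = n%:R.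
Proof. by apply/(@complexI R); rewrite -norm_complexE normr_nat rmorph_nat. Qed.

(** Follows from 1 + y <= exp y and a geometric sum; the bound is uniform in [N]. *)
Lemma prod_1D_geom_le (R : realType) (x r : R) N : 0 <= x -> 0 <= r < 1 ->
  \prod_(0 <= j < N) (1 + x * r ^+ j) <= expR (x / (1 - r)).
Proof.
move=> x0 /andP[r0 r1].
have r1' : 0 < 1 - r by rewrite subr_gt0.
apply: (@le_trans _ _ (\prod_(0 <= j < N) expR (x * r ^+ j))).
  apply: ler_prod => j _; rewrite expR_ge1Dx andbT addr_ge0 // mulr_ge0 // exprn_ge0 //.
rewrite -expR_sum ler_expR -big_distrr /=; apply: ler_wpM2l => //.
rewrite -div1r ler_pdivlMr // mulrC big_mkord -opprB mulNr -subrX1 opprB.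
by rewrite lerBlDr lerDl exprn_ge0.
Qed.

(** The partial products are, up to the first, partial sums of their own differences, and |p_(n+1) -
    p_n| <= P_(n+1) - P_n for the products P of the 1 + |a| |q|^j, which are bounded. *)
Lemma cvg_qpoch (R : realType) (a q : C R) : `|q| < 1 ->
  cvgn (fun N => \prod_(0 <= j < N) (1 - a * q ^+ j)).
Proof.
rewrite norm_complexE ltcR => q1.
set p := (fun N => _); set r := Normc.normc q.
pose P N := \prod_(0 <= j < N) (1 + Normc.normc a * r ^+ j).
have pP N : Normc.normc (p N) <= P N.
  rewrite /p /P; elim: N => [|N IH]; first by rewrite !big_geq // Normc.normc1.
  rewrite !big_nat_recr //= Normc.normcM ler_pM ?normc_ge0 //.
  by rewrite (le_trans (le_normcD _ _)) // normcN Normc.normc1 Normc.normcM normcX.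
rewrite (_ : p = (fun N => p 0%N + series (telescope p) N)); last first.
  by apply/funext => N; exact: eq_sum_telescope.
apply: is_cvgD; first exact: is_cvg_cst.
apply: (cvg_series_bounded R _ (expR (Normc.normc a / (1 - r)))) => N.
apply: (@le_trans _ _ (\sum_(0 <= n < N) (P n.+1 - P n))).
  apply: ler_sum => n _; rewrite /telescope /=.
  have -> : p n.+1 = p n * (1 - a * q ^+ n) by rewrite /p big_nat_recr.
  have -> : P n.+1 = P n * (1 + Normc.normc a * r ^+ n) by rewrite /P big_nat_recr.
  have -> : p n * (1 - a * q ^+ n) - p n = - (p n * (a * q ^+ n)) by ring.
  have -> : P n * (1 + Normc.normc a * r ^+ n) - P n = P n * (Normc.normc a * r ^+ n) by ring.
  by rewrite normcN !Normc.normcM normcX ler_wpM2r // mulr_ge0 ?normc_ge0 // exprn_ge0 // normc_ge0.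
rewrite telescope_sumr // lerBlDr.
apply: le_trans (prod_1D_geom_le R _ _ N (normc_ge0 R a) _) _; first by rewrite normc_ge0.
by rewrite lerDl /P big_geq.
Qed.

(** The terms tend to 0 because their series converges: its partial sums increase and, by
    [sum_arith_geom], stay below r / (1 - r)^2. *)
Lemma cvg_natM_expr (R : realType) (r : R) : 0 <= r < 1 ->
  (fun n => n%:R * r ^+ n) @ \oo --> (0 : R).
Proof.
move=> /andP[r0 r1].
have r1' : 0 < 1 - r by rewrite subr_gt0.
apply: cvg_series_cvg_0; apply: nondecreasing_is_cvgn.
  by apply/nondecreasing_seqP => n; rewrite seriesSr lerDl mulr_ge0 // exprn_ge0.
exists (r / (1 - r) ^+ 2) => _ [N _ <-].
rewrite ler_pdivlMr ?exprn_gt0 // mulrC /series /=.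
case: N => [|N]; first by rewrite big_geq // mulr0.
rewrite big_mkord sum_arith_geom -addrA gerDl addrC subr_le0.
apply: ler_pM; rewrite ?ler0n ?exprn_ge0 ?ler_nat //.
by rewrite (exprS _ N.+1) ler_piMl ?exprn_ge0 // ltW.
Qed.

Lemma cvg_sum_natM_expr (R : realType) (y : C R) : `|y| < 1 ->
  (fun N => \sum_(1 <= n < N) n%:R * y ^+ n) @ \oo --> (y / (1 - y) ^+ 2 : C R).
Proof.
move=> y1.
have y1' : 1 - y != 0.
  by apply/eqP => /subr0_eq y_eq; rewrite -y_eq normr1 ltxx in y1.
have t0 : (fun n => n%:R * y ^+ n) @ \oo --> (0 : C R).
  apply: (cvg0_complex R _ (fun n => n%:R * Normc.normc y ^+ n)) => [n|].
    by rewrite Normc.normcM normcX normc_nat.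
  by apply: cvg_natM_expr; rewrite normc_ge0 -ltcR.
rewrite -cvg_shiftS /=.
have -> : (fun N => \sum_(1 <= n < N.+1) n%:R * y ^+ n) =
   (fun N => (y - N.+1%:R * y ^+ N.+1 + y ^+ 2 * (N%:R * y ^+ N)) / (1 - y) ^+ 2).
  apply/funext => N; apply: (mulIf (expf_neq0 2 y1')); rewrite divfK ?expf_neq0 //.
  rewrite mulrC; have := sum_arith_geom _ y N.
  rewrite -(big_mkord xpredT (fun k => k%:R * y ^+ k)) /= big_ltn // mul0r add0r => ->.
  by rewrite !exprS; ring.
have -> : y / (1 - y) ^+ 2 = (y - 0 + y ^+ 2 * 0) / (1 - y) ^+ 2 by rewrite mulr0 addr0 subr0.
apply: cvgM; last exact: cvg_cst.
apply: cvgD; first apply: cvgB; first exact: cvg_cst.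
  by rewrite (cvg_shiftS (fun n => n%:R * y ^+ n)).
exact: (cvgM (cvg_cst _) t0).
Qed.

(** * The limit of the main polynomials *)

(** The ring is arbitrary so that the same expression can be taken at the complex q and at the real
    |q|. *)
Definition main_value (S : comNzRingType) (z : S) (K : nat) : S :=
  2 * z * (\prod_(0 <= j < K) (1 + z ^+ 2 * z ^+ j)) ^+ 2
        * (\prod_(0 <= j < K) (1 + z ^+ 2 * (z ^+ 2) ^+ j)) ^+ 2.

Lemma main_poly_eval (S : comNzRingType) (z : S) K L : (size (main_poly K) <= L)%N ->
  \sum_(0 <= n < L) ((main_poly K)`_n)%:~R * z ^+ n = main_value S z K.
Proof.
move=> sL.
have sz : (size (map_poly (intr : int -> S) (main_poly K)) <= L)%N by exact: leq_trans (size_poly _ _) sL.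
have := horner_coef_wide z sz.
rewrite big_mkord (eq_bigr (fun i : 'I_L => ((main_poly K)`_i)%:~R * z ^+ i)) => [<-|i _]; last first.
  by rewrite coef_map_id0.
rewrite /main_poly /main_value !big_mkord !(rmorphM, rmorphXn, rmorph_prod, rmorph_nat) /=.
rewrite !(hornerM, hornerXn, horner_exp, horner_prod) map_polyX hornerX.
congr (_ * _ * _ ^+ 2 * _ ^+ 2).
- by rewrite -[2]/(2%:R) hornerMn hornerC.
- apply: eq_bigr => i _; rewrite rmorphD rmorph1 /= map_polyXn !hornerE.
  by rewrite -exprD.
- apply: eq_bigr => i _; rewrite rmorphD rmorph1 /= map_polyXn !hornerE.
  by rewrite -exprM -exprD -mul2n mulnS.
Qed.

Lemma main_value_real_le (R : realType) (r : R) K : 0 <= r < 1 ->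
  main_value R r K <= 2 * r * (expR (r ^+ 2 / (1 - r))) ^+ 2 * (expR (r ^+ 2 / (1 - r ^+ 2))) ^+ 2.
Proof.
move=> /andP[r0 r1].
have prod_ge0 x : 0 <= x -> 0 <= \prod_(0 <= j < K) (1 + r ^+ 2 * x ^+ j).
  by move=> x0; apply: prodr_ge0 => j _; rewrite addr_ge0 // mulr_ge0 // exprn_ge0.
have r20 : 0 <= r ^+ 2 by rewrite exprn_ge0.
rewrite /main_value; apply: ler_pM; rewrite ?mulr_ge0 ?exprn_ge0 ?prod_ge0 //.
  apply: ler_wpM2l; first by rewrite mulr_ge0.
  rewrite lerXn2r ?nnegrE ?prod_ge0 ?expR_ge0 //.
  by apply: prod_1D_geom_le; rewrite ?r0.
rewrite lerXn2r ?nnegrE ?prod_ge0 ?expR_ge0 //.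
by apply: prod_1D_geom_le; rewrite ?r20 // expr_lt1.
Qed.

Lemma cvg_qpoch_inf (R : realType) (x q : C R) : `|q| < 1 ->
  (fun N => \prod_(0 <= j < N) (1 + x * q ^+ j)) @ \oo --> qpoch_inf (- x) q.
Proof.
move=> q1; have := cvg_qpoch R (- x) q q1; rewrite /qpoch_inf.
suff -> : (fun N => \prod_(0 <= j < N) (1 - - x * q ^+ j)) =
   (fun N => \prod_(0 <= j < N) (1 + x * q ^+ j)) by [].
by apply/funext => N; apply: eq_bigr => j _; rewrite mulNr opprK.
Qed.

Lemma cvg_main_value (R : realType) (q : C R) : `|q| < 1 ->
  main_value (C R) q @ \oo -->
  2 * q * qpoch_inf (- q ^+ 2) q ^+ 2 * qpoch_inf (- q ^+ 2) (q ^+ 2) ^+ 2.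
Proof.
move=> q1; have q21 : `|q ^+ 2| < 1 by rewrite normrX expr_lt1.
have c1 := cvg_qpoch_inf R (q ^+ 2) q q1.
have c2 := cvg_qpoch_inf R (q ^+ 2) (q ^+ 2) q21.
have sq (u : nat -> C R) (l : C R) : u @ \oo --> l -> (fun n => u n ^+ 2) @ \oo --> l ^+ 2.
  by move=> ul; exact: (cvgM ul ul).
exact: (cvgM (cvgM (cvg_cst (2 * q)) (sq _ _ c1)) (sq _ _ c2)).
Qed.

(** The sum of the stable coefficients below [K] differs from the value of [main_poly K] by its
    terms of degree at least [K]. These are dominated by the tail of the stable series at |q|, which
    converges by the uniform bound on [main_value]. *)
Lemma cvg_sum_main_poly (R : realType) (q : C R) : `|q| < 1 ->
  (fun N => \sum_(0 <= n < N) ((main_poly n)`_n)%:~R * q ^+ n) @ \oo -->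
  2 * q * qpoch_inf (- q ^+ 2) q ^+ 2 * qpoch_inf (- q ^+ 2) (q ^+ 2) ^+ 2.
Proof.
move=> q1; set r := Normc.normc q.
have r0 : 0 <= r by exact: normc_ge0.
have r1 : r < 1 by rewrite -ltcR.
pose a N : R := \sum_(0 <= n < N) ((main_poly n)`_n)%:~R * r ^+ n.
have a_nd : {homo a : m n / (m <= n)%N >-> m <= n}.
  apply/nondecreasing_seqP => n; rewrite /a big_nat_recr //= lerDl.
  by rewrite mulr_ge0 ?exprn_ge0 // ler0z main_poly_coef_ge0.
have diag (S : comNzRingType) (z : S) K :
    \sum_(0 <= n < K) ((main_poly n)`_n)%:~R * z ^+ n = \sum_(0 <= n < K) ((main_poly K)`_n)%:~R * z ^+ n.
  by apply: eq_big_nat => n /andP[_ nK]; rewrite (main_poly_stable n n K) // ltnW.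
have a_cvg : cvgn a.
  apply: nondecreasing_is_cvgn => //.
  exists (2 * r * (expR (r ^+ 2 / (1 - r))) ^+ 2 * (expR (r ^+ 2 / (1 - r ^+ 2))) ^+ 2) => _ [N _ <-].
  apply: le_trans (main_value_real_le R r N _); last by rewrite r0.
  rewrite -(main_poly_eval R r N (maxn N (size (main_poly N)))) ?leq_maxr //.
  rewrite /a diag [leRHS](big_cat_nat (n := N)) ?leq_maxl //= lerDl.
  by apply: sumr_ge0 => n _; rewrite mulr_ge0 ?exprn_ge0 // ler0z main_poly_coef_ge0.
have err K : Normc.normc (main_value (C R) q K - \sum_(0 <= n < K) ((main_poly n)`_n)%:~R * q ^+ n)
    <= limn a - a K.
  rewrite -(main_poly_eval _ q K (maxn K (size (main_poly K)))) ?leq_maxr // diag.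
  rewrite (big_cat_nat (n := K) (p := maxn _ _)) ?leq_maxl //= addrAC subrr add0r.
  apply: (@le_trans _ _ (a (maxn K (size (main_poly K))) - a K)); last first.
    by rewrite lerD2r; exact: nondecreasing_cvgn_le.
  rewrite /a (big_cat_nat (m := 0) (n := K) (p := maxn _ _)) ?leq_maxl //= addrAC subrr add0r.
  apply: le_trans (le_normc_sum _ _ _ _ _) _; apply: ler_sum => n _.
  rewrite Normc.normcM normcX -/r; apply: ler_wpM2r; first exact: exprn_ge0.
  move: (main_poly_coef_ge0 K n) (main_poly_coef_le K n); case: ((main_poly K)`_n) => // m _.
  by rewrite -pmulrn normc_nat -(ler_int R) -pmulrn.
have -> : (fun N => \sum_(0 <= n < N) ((main_poly n)`_n)%:~R * q ^+ n) =
   (fun N => main_value (C R) q N - (main_value (C R) q N - \sum_(0 <= n < N) ((main_poly n)`_n)%:~R * q ^+ n)).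
  by apply/funext => N; rewrite subKr.
rewrite -[X in _ --> X]subr0; apply: cvgB; first exact: cvg_main_value.
apply: (cvg0_complex R _ (fun K => limn a - a K)) => //.
rewrite -(subrr (limn a)); apply: cvgB; [exact: cvg_cst|exact: a_cvg].
Qed.

(** * Identities of functions in the unit disc *)

Theorem theorem5 (R : realType) (q : C R) (hq : `|q| < 1) :
  [/\ cvgn (fun N : nat => \sum_(1 <= n < N) (A n)%:R * q ^+ n),
      \big[+%R/0]_(1 <= n <oo) ((A n)%:R * q ^+ n)
      = 2 * q * qpoch_inf (- q ^+ 2) q ^+ 2 * qpoch_inf (- q ^+ 2) (q ^+ 2) ^+ 2
        - q / (1 + q) ^+ 2,
      cvgn (fun N : nat => \sum_(1 <= n < N) (-1) ^+ n * n%:R * q ^+ n) &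
      2 * q * qpoch_inf (- q ^+ 2) q ^+ 2 * qpoch_inf (- q ^+ 2) (q ^+ 2) ^+ 2
        - q / (1 + q) ^+ 2
      = 2 * q * qpoch_inf (- q ^+ 2) q ^+ 2 * qpoch_inf (- q ^+ 2) (q ^+ 2) ^+ 2
        + \big[+%R/0]_(1 <= n <oo) ((-1) ^+ n * n%:R * q ^+ n)]
  /\
  [/\ cvgn (fun N : nat => \sum_(1 <= n < N) (A' n)%:~R * q ^+ n),
      \big[+%R/0]_(1 <= n <oo) ((A' n)%:~R * q ^+ n) = q / (1 - q) ^+ 2,
      cvgn (fun N : nat => \sum_(1 <= n < N) n%:R * q ^+ n) &
      q / (1 - q) ^+ 2 = \big[+%R/0]_(1 <= n <oo) (n%:R * q ^+ n)].
Proof.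
have limE (u : nat -> C R) (l : C R) : u @ \oo --> l -> limn u = l.
  by move=> ul; apply: cvg_lim => //; exact: norm_hausdorff.
have cvgE (u : nat -> C R) (l : C R) : u @ \oo --> l -> cvgn u.
  by move=> ul; apply/cvg_ex; exists l.
have nat_cvg := cvg_sum_natM_expr R q hq.
have A'_cvg : (fun N => \sum_(1 <= n < N) (A' n)%:~R * q ^+ n) @ \oo --> q / (1 - q) ^+ 2.
  rewrite (_ : (fun N => _) = (fun N => \sum_(1 <= n < N) n%:R * q ^+ n)) //.
  apply/funext => N; apply: eq_big_nat => n /andP[n0 _].
  by rewrite A'_gen_poly coef_gen_polyN1 // rmorph_nat.
have alt_cvg : (fun N => \sum_(1 <= n < N) (-1) ^+ n * n%:R * q ^+ n) @ \oo --> - (q / (1 + q) ^+ 2).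
  have := cvg_sum_natM_expr R (- q); rewrite normrN opprK mulNr => /(_ hq).
  rewrite (_ : (fun N => _) = (fun N => \sum_(1 <= n < N) (-1) ^+ n * n%:R * q ^+ n)) //.
  by apply/funext => N; apply: eq_bigr => n _; rewrite (exprNn q) mulrCA mulrA.
have A_cvg : (fun N => \sum_(1 <= n < N) (A n)%:R * q ^+ n) @ \oo -->
    2 * q * qpoch_inf (- q ^+ 2) q ^+ 2 * qpoch_inf (- q ^+ 2) (q ^+ 2) ^+ 2 - q / (1 + q) ^+ 2.
  have -> : (fun N => \sum_(1 <= n < N) (A n)%:R * q ^+ n) =
      (fun N => \sum_(0 <= n < N) ((main_poly n)`_n)%:~R * q ^+ n +
                \sum_(1 <= n < N) (-1) ^+ n * n%:R * q ^+ n); last first.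
    exact: cvgD (cvg_sum_main_poly R q hq) alt_cvg.
  apply/funext => -[|N]; first by rewrite !big_geq // addr0.
  (* The sum over [main_poly] starts at 0; its term there vanishes because [main_poly 0] is a
     multiple of X. *)
  rewrite [RHS]addrC [X in _ = _ + X]big_ltn // [X in _ = _ + (X + _)](_ : _ = 0); last first.
     by rewrite /main_poly big_ord0 big_ord0 !(expr1n, mulr1) coefMX /= mulr0z ?mul0r.
  rewrite add0r addrC -big_split /=; apply: eq_big_nat => n /andP[n0 _].
  have -> : (A n)%:R = ((A n)%:Z)%:~R :> C R by rewrite -pmulrn.
  rewrite A_gen_poly coef_gen_poly1 // rmorphD rmorphM rmorphXn rmorphN1 rmorph_nat /= mulrDl.
  by rewrite [_%:R * (-1) ^+ n]mulrC.
split.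
- split; [exact: cvgE A_cvg | exact: limE A_cvg | exact: cvgE alt_cvg | ].
  by rewrite (limE _ _ alt_cvg).
- split; [exact: cvgE A'_cvg | exact: limE A'_cvg | exact: cvgE nat_cvg | ].
  by rewrite (limE _ _ nat_cvg).
Qed.
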